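(* There are absolute constants $A,B$ such that for all integers $m\ge n\ge1$ there exists an $(m,n)$-superconcentrator with at most $A m$ edges and depth at most $\alpha(m,n)+B$, where $\alpha(m,n)$ is the two-parameter inverse Ackermann function defined in the context.
   Context: An $(m,n)$-network is a finite directed acyclic graph with $m$ inputs and $n$ outputs. It is an $(m,n)$-superconcentrator if for any subset $X$ of the inputs and any subset $Y$ of the outputs with $|X|=|Y|$ there exist $|X|$ pairwise vertex-disjoint paths connecting $X$ to $Y$. Depth is the maximum number of edges on a directed path from an input to an output. For $f:\mathbb{N}\to\mathbb{N}$ with $f(n)<n$ for all $n>1$, let $f^{(i)}$ be the $i$-fold composition ($f^{(1)}=f$) and $f^*(n)=\min\{i\ge1: f^{(i)}(n)\le 1\}$. Define $\lambda_1(n)=\lfloor\sqrt n\rfloor$, $\lambda_2(n)=\lceil\log_2 n\rceil$, and $\lambda_d(n)=\lambda_{d-2}^*(n)$ for $d\ge3$. For $m\ge n$: $\alpha(m,n)=\min\{d\ge 1: m/n\ge\lambda_d(n)\}$ if $m\ge128n$, and $\alpha(m,n)=\min\{d\ge 1:\lambda_d(n)\le4\}$ otherwise. *)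

(* Defs.v *)
From Stdlib Require PeanoNat.
From mathcomp Require Import all_boot all_order all_algebra zify.

Set Implicit Arguments.
Unset Strict Implicit.
Unset Printing Implicit Defensive.

Import GRing.Theory Num.Theory.

Record shrinking := Shrinking {
  shrink_fun :> nat -> nat;
  shrinkP : forall n, 1 < n -> shrink_fun n < n }.

Lemma iter_shrink_le1 (f : shrinking) (n : nat) :
  exists2 i, i <= n.-1 & iter i f n <= 1.
Proof.
elim/ltn_ind: n => n IHn; have [n_gt1|n_le1] := ltnP 1 n; last by exists 0.
have [i ile fi_le1] := IHn _ (shrinkP f n_gt1).
by exists i.+1; [have := shrinkP f n_gt1; lia | rewrite iterSr].
Qed.

Lemma star_ex (f : shrinking) (n : nat) :
  exists i, (0 < i) && (iter i f n <= 1).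
Proof.
by have [i _ fi_le1] := iter_shrink_le1 f (f n); exists i.+1; rewrite iterSr.
Qed.

Definition star_fun (f : shrinking) (n : nat) : nat := ex_minn (star_ex f n).

Lemma star_fun_leq (f : shrinking) (n i : nat) :
  iter i f (f n) <= 1 -> star_fun f n <= i.+1.
Proof.
by move=> fi_le1; rewrite /star_fun; case: ex_minnP => j _; apply; rewrite iterSr.
Qed.

Lemma star_fun_shrink (f : shrinking) (n : nat) : 1 < n -> star_fun f n < n.
Proof.
move=> n_gt1; have [i ile /star_fun_leq le_i] := iter_shrink_le1 f (f n).
by have := shrinkP f n_gt1; lia.
Qed.

Definition star (f : shrinking) : shrinking := Shrinking (@star_fun_shrink f).

Lemma sqrt_shrink (n : nat) : 1 < n -> PeanoNat.Nat.sqrt n < n.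
Proof. by move=> n_gt1; have := PeanoNat.Nat.sqrt_lt_lin n; lia. Qed.

Definition floor_sqrt : shrinking := Shrinking sqrt_shrink.

Lemma up_log2_shrink (n : nat) : 1 < n -> up_log 2 n < n.
Proof.
case: n => // n n_gt0; rewrite ltnS; apply: up_log_min => //.
exact: ltn_expl.
Qed.

Definition ceil_log2 : shrinking := Shrinking up_log2_shrink.

(* The hierarchy starts at index 1; the value at 0 is never used. *)
Fixpoint lambda (d : nat) : shrinking :=
  match d with
  | 0 | 1 => floor_sqrt
  | 2 => ceil_log2
  | (_.+1 as d').+2 => star (lambda d')
  end.

Lemma lambdaS2 (d : nat) : 0 < d -> lambda d.+2 = star (lambda d).
Proof. by case: d. Qed.

Lemma lambda_odd_subn2 (j k : nat) : 3 < k -> lambda j.*2.+1 k + 2 <= k.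
Proof.
elim: j k => [|j IHj] k k_gt3.
  rewrite /= -[_ <= _]/(PeanoNat.Nat.sqrt k + 2 <= k).
  have := PeanoNat.Nat.sqrt_spec k (PeanoNat.Nat.le_0_l k).
  move: (PeanoNat.Nat.sqrt k) => r [/leP]; rewrite !multE => r2 _.
  by nia.
rewrite doubleS lambdaS2 //; set f := lambda _ in IHj *.
have [i ile /star_fun_leq le_i] := iter_shrink_le1 f (f k).
by have := IHj _ k_gt3; rewrite /star /= ; lia.
Qed.

Lemma lambda_odd_leq (j n : nat) : lambda j.*2.+1 n <= maxn 4 (n - j).
Proof.
elim: j => [|j IHj].
  have [n_gt1|] := ltnP 1 n.
    by rewrite leq_max subn0 (ltnW (shrinkP (lambda 1) n_gt1)) orbT.
  by case: n => [|[]].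
rewrite doubleS lambdaS2 //.
have := @lambda_odd_subn2 j; set f := lambda _ in IHj * => f_sub2.
have [i ile fi_le1] := iter_shrink_le1 f (f n); have := star_fun_leq fi_le1.
have [fn_gt3|] := ltnP 3 (f n); last by rewrite /star /=; lia.
have [k kle fk_le1] := iter_shrink_le1 f (f (f n)).
have := @star_fun_leq f n k.+1; rewrite iterSr => /(_ fk_le1).
by have := f_sub2 _ fn_gt3; rewrite /star /=; lia.
Qed.

Definition alpha_cond (m n d : nat) : bool :=
  (0 < d) &&
  (if 128 * n <= m then ((lambda d n)%:R <= m%:R / n%:R :> rat)%R
   else lambda d n <= 4).

Lemma alpha_ex (m n : nat) : exists d, alpha_cond m n d.
Proof.
have [->|n_gt0] := posnP n.
  by exists 1; rewrite /alpha_cond /= invr0 mulr0.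
exists n.*2.+1; rewrite /alpha_cond ltn0Sn.
have := lambda_odd_leq n n; rewrite subnn maxn0.
move: (lambda _ n) => l le4; case: ifP => // le_m.
rewrite ler_pdivlMr ?ltr0n // -natrM ler_nat; nia.
Qed.

Definition alpha (m n : nat) : nat := ex_minn (alpha_ex m n).

Record network (m n : nat) := Network {
  vertex : finType;
  edge : rel vertex;
  inputs : {set vertex};
  outputs : {set vertex};
  acyclic : forall c : seq vertex, cycle edge c -> c = [::];
  card_inputs : #|inputs| = m;
  card_outputs : #|outputs| = n;
  disjoint_io : [disjoint inputs & outputs] }.

Definition num_edges (m n : nat) (G : network m n) : nat :=
  #|[set xy : vertex G * vertex G | edge xy.1 xy.2]|.

Definition path_between (m n : nat) (G : network m n)
    (X Y : {set vertex G}) (s : seq (vertex G)) : bool :=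
  if s is x :: p then [&& x \in X, path (@edge _ _ G) x p & last x p \in Y]
  else false.

Definition superconcentrator (m n : nat) (G : network m n) : Prop :=
  forall X Y : {set vertex G},
    X \subset inputs G -> Y \subset outputs G -> #|X| = #|Y| ->
  exists P : 'I_#|X| -> seq (vertex G),
    (forall i, path_between X Y (P i)) /\
    (forall i j, i != j -> [disjoint P i & P j]).

(* By acyclicity a path visits each vertex at most once, so it has fewer than
   #|vertex G| edges (see depth_leqP). *)
Definition depth (m n : nat) (G : network m n) : nat :=
  \max_(k < #|vertex G| |
        [exists t : k.+1.-tuple (vertex G),
           path_between (inputs G) (outputs G) t]) k.

Lemma path_uniq (m n : nat) (G : network m n) (x : vertex G) p :
  path (@edge _ _ G) x p -> uniq (x :: p).
Proof.
elim: p x => // y p IHp x /= /andP[xy yp]; rewrite -/(uniq (y :: p)) IHp // andbT.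
apply/negP => /splitPl; rewrite -/(x :: _) => x_in.
case: x_in xy yp => p1 p2 p1x xy; rewrite cat_path => /andP[yp1 _].
have /(@acyclic _ _ G) // : cycle (@edge _ _ G) (y :: p1).
by rewrite /= rcons_path yp1 p1x.
Qed.

Lemma depth_leqP (m n : nat) (G : network m n) (k : nat) :
  depth G <= k <->
  (forall x p, x \in inputs G -> path (@edge _ _ G) x p ->
     last x p \in outputs G -> size p <= k).
Proof.
split=> [le_k x p xI xp pO | le_k].
  have ltp : size p < #|vertex G|.
    by rewrite -[(size p).+1]/(size (x :: p)) -(card_uniqP (path_uniq xp)) max_card.
  apply: leq_trans le_k; apply: (@leq_bigmax_cond _ _ _ (Ordinal ltp)).
  by apply/existsP; exists (in_tuple (x :: p)); rewrite /= xI xp.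
apply/bigmax_leqP => i /existsP[[[|x p] //= /eqP [<-]]] /and3P[xI xp pO].
exact: le_k xp pO.
Qed.

(* Main.v *)
Require Import Defs.
From mathcomp Require Import all_boot all_algebra zify.

Set Implicit Arguments.
Unset Strict Implicit.
Unset Printing Implicit Defensive.

(** A network is a superconcentrator as soon as, for every [j], no set of fewer
    than [j] inner vertices separates [j] inputs from [j] outputs.  In a dag,
    vertex-disjoint paths are matchings of the bipartite graph in which inner
    vertices may also be matched to themselves, so Hall's theorem replaces
    Menger's.  The separation property may be achieved by a different subnetwork
    for each range of [j], and these subnetworks share only inputs and outputs.

    Write [n] for the number of inputs and outputs.  Suppose that the ranges
    [n / r <= j] cost [A n f(r)] edges, for all [n] and [r].  With
    [s = Theta(f(r))], compress inputs and outputs by a factor [s] through random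
    graphs of constant degree, which double every set of at most [n / (64 s^2)]
    vertices; the old network on [n / s] vertices then costs at most [A n / 4]
    and serves [n / r <= j <= n / (64 s^2)].  The gap up to [n / f(r)] is closed
    in bounded depth with [O(n)] edges: compress by about [sqrt s], then use, for
    each dyadic range of [j], one layer of random disperser edges.  So
    [n / r <= j <= n / f(r)] costs [A n], and iterating [f] down to [1] gives
    cost [A n f^*(r)] with the same [A] and two more levels.

    The square root starts the odd levels; the even levels start from [star] of
    halving, which is [ceil_log2].  For [m > n], two more random layers first
    compress [m] to [8 sqrt(m n)] and then to [4 n]. *)

(** * Hall's theorem *)

Section Hall.

Variables (A B : finType).
Implicit Types (nb : A -> {set B}) (X D : {set A}) (Y : {set B}).

Definition hood nb X : {set B} := \bigcup_(a in X) nb a.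

Lemma hoodP nb X b :
  reflect (exists2 a, a \in X & b \in nb a) (b \in hood nb X).
Proof. exact: bigcupP. Qed.

Lemma hoodS nb X X' : X \subset X' -> hood nb X \subset hood nb X'.
Proof.
move=> /subsetP sub; apply/subsetP => b /hoodP[a aX ba].
by apply/hoodP; exists a; first exact: sub.
Qed.

Lemma hoodD nb X Y : hood (fun a => nb a :\: Y) X = hood nb X :\: Y.
Proof.
apply/setP => b; rewrite inE; apply/hoodP/andP => [[a aX]|[bY /hoodP[a aX ba]]].
  by rewrite inE => /andP[bY ba]; split=> //; apply/hoodP; exists a.
by exists a; rewrite // inE bY.
Qed.

(** Induction on [#|D|]. A tight proper nonempty subset is matched first, and the rest then avoids
    its neighbours. If there is none, every proper nonempty subset has a neighbour to spare, so [a]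
    may take any [b]. *)
Theorem hall (b0 : B) nb D :
  (forall X, X \subset D -> #|X| <= #|hood nb X|) ->
  exists2 f : A -> B, {in D &, injective f} & {in D, forall a, f a \in nb a}.
Proof.
move: {2}#|D| (leqnn #|D|) => n; elim: n nb D => [|n IHn] nb D.
  rewrite leqn0 cards_eq0 => /eqP-> _.
  by exists (fun=> b0) => [a|a]; rewrite inE.
move=> leDn hallD; have [->|[a aD]] := set_0Vmem D.
  by exists (fun=> b0) => [x|x]; rewrite inE.
have [|loose] := boolP [exists X : {set A},
    [&& X \proper D, X != set0 & #|hood nb X| <= #|X|]].
  case/existsP => X /and3P[XD X0 tight]; have XsD := proper_sub XD.
  have X_gt0 : 0 < #|X| by rewrite card_gt0.
  have cardD : #|D :\: X| = #|D| - #|X|.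
    by rewrite cardsD (setIidPr XsD).
  have := proper_card XD => ltX.
  have [|Z ZX|f1 f1I f1nb] := IHn nb X; first by lia.
    by apply: hallD; apply: subset_trans XsD.
  have [||f2 f2I f2nb] := IHn (fun a => nb a :\: hood nb X) (D :\: X).
  - by rewrite cardD; lia.
  - move=> Z ZD; rewrite hoodD.
    have ZsD : Z \subset D by apply: subset_trans ZD (subsetDl _ _).
    have dXZ : [disjoint X & Z].
      rewrite disjoint_sym disjoints_subset; apply: subset_trans ZD _.
      by rewrite setDE subsetIr.
    have := hallD (X :|: Z); rewrite subUset XsD ZsD => /(_ isT).
    rewrite cardsU (eqP (_ : X :&: Z == set0)) ?setI_eq0 // cards0 subn0.
    rewrite {1}/hood bigcup_setU -!/(hood _ _) => le.
    have := cardsD (hood nb Z) (hood nb X).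
    have := cardsU (hood nb X) (hood nb Z); rewrite setIC; lia.
  exists (fun a => if a \in X then f1 a else f2 a) => [x y xD yD|x xD] /=.
    have f1h z : z \in X -> f1 z \in hood nb X.
      by move=> zX; apply/hoodP; exists z; last exact: f1nb.
    have f2h z : z \in D -> z \notin X -> f2 z \notin hood nb X.
      by move=> zD zX; have := f2nb z; rewrite !inE zX zD => /(_ isT)/andP[].
    case: ifPn => xX; case: ifPn => yX; first exact: f1I.
    - by move=> eq12; have := f2h _ yD yX; rewrite -eq12 f1h.
    - by move=> eq12; have := f2h _ xD xX; rewrite eq12 f1h.
    - by apply: f2I; rewrite inE ?xX ?yX.
  case: ifPn => xX; first exact: f1nb.
  by have := f2nb x; rewrite !inE xX xD => /(_ isT)/andP[].
have hoodgt X : X \proper D -> X != set0 -> #|X| < #|hood nb X|.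
  move=> XD X0; rewrite ltnNge; apply: contra loose => le.
  by apply/existsP; exists X; rewrite XD X0.
have [b ba] : exists b, b \in nb a.
  apply/set0Pn; rewrite -card_gt0; have := hallD [set a].
  by rewrite sub1set aD cards1 /hood big_set1 => /(_ isT).
have cardD := cardsD1 a D; rewrite aD in cardD.
have [||f fI fnb] := IHn (fun a => nb a :\ b) (D :\ a); first by lia.
  move=> Z ZD; rewrite hoodD.
  have [->|Z0] := eqVneq Z set0; first by rewrite cards0.
  have /hoodgt/(_ Z0) : Z \proper D by apply: sub_proper_trans ZD (properD1 aD).
  have := cardsD1 b (hood nb Z); lia.
exists (fun x => if x == a then b else f x) => [x y xD yD|x xD] /=.
  case: eqP => [->|/eqP xa]; case: eqP => [->|/eqP ya] //.
  - move=> eqb; have := fnb y; rewrite !inE ya yD => /(_ isT).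
    by rewrite -eqb eqxx.
  - move=> eqb; have := fnb x; rewrite !inE xa xD => /(_ isT).
    by rewrite eqb eqxx.
  - by apply: fI; rewrite !inE ?xa ?ya.
case: eqP => [->|/eqP xa] //; have := fnb x; rewrite !inE xa xD => /(_ isT).
by case/andP.
Qed.

End Hall.

(** * From separation to disjoint paths *)

(* The network without its input and output vertices: [src x] and [snk y] are the
   inner neighbours of the input [x] and of the output [y]. *)
Record gadget (I O : finType) := Gadget {
  inner : finType;
  src : I -> {set inner};
  arcs : inner -> {set inner};
  snk : O -> {set inner};
  level : inner -> nat;
  level_arcs : forall u v, v \in arcs u -> level u < level v }.

Definition gadget_cost (I O : finType) (G : gadget I O) : nat :=
  \sum_i #|src G i| + \sum_(v : inner G) #|arcs v| + \sum_o #|snk G o|.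

Inductive reach (I O : finType) (G : gadget I O) (S : {set inner G}) (o : O) :
    inner G -> Prop :=
  | reach_snk v : v \notin S -> v \in snk G o -> reach S o v
  | reach_arcs v w : v \notin S -> w \in arcs v -> reach S o w -> reach S o v.

(** Cuts contain inner vertices only: deleting inputs or outputs amounts to shrinking [X] or [Y]. *)
Definition robust (I O : finType) (G : gadget I O) (j : nat) : Prop :=
  forall (X : {set I}) (Y : {set O}) (S : {set inner G}),
    j <= #|X| -> j <= #|Y| -> #|S| < j ->
  exists x y u, [/\ x \in X, y \in Y, u \in src G x & reach S y u].

Lemma reach_notin (I O : finType) (G : gadget I O) (S : {set inner G}) o v :
  reach S o v -> v \notin S.
Proof. by case. Qed.

Lemma card_set_sum (A B : finType) (Z : {set A + B}) :
  #|Z| = #|[set a | inl a \in Z]| + #|[set b | inr b \in Z]|.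
Proof.
by rewrite -!sum1_card big_sumType /=; congr (_ + _); apply: eq_bigl => x; rewrite inE.
Qed.

Lemma card_rel (A B : finType) (r : A -> B -> bool) :
  #|[set p : A * B | r p.1 p.2]| = \sum_a #|[set b | r a b]|.
Proof.
rewrite -sum1_card (eq_bigr (fun a => \sum_(b | r a b) 1)).
  by rewrite pair_big_dep /=; apply: eq_bigl => p; rewrite inE.
by move=> a _; rewrite -sum1_card; apply: eq_bigl => x; rewrite inE.
Qed.

Lemma card_rel_sym (A B : finType) (r : A -> B -> bool) :
  \sum_a #|[set b | r a b]| = \sum_b #|[set a | r a b]|.
Proof.
have E (C E : finType) (q : C -> E -> bool) :
    \sum_a #|[set b | q a b]| = \sum_a \sum_b (q a b : nat).
  apply: eq_bigr => a _; rewrite -sum1_card [LHS]big_mkcond.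
  by apply: eq_bigr => b _; rewrite inE; case: q.
by rewrite !E exchange_big.
Qed.

Section GadgetNetwork.

Variables (m n b : nat) (I O : finType) (G : gadget I O).
Hypotheses (cardI : #|I| = m) (cardO : #|O| = n).
Hypothesis level_lt : forall v : inner G, level v < b.

Let T : finType := (I + inner G + O)%type.

Definition net_edge (s t : T) : bool :=
  match s, t with
  | inl (inl x), inl (inr v) => v \in src G x
  | inl (inr u), inl (inr v) => v \in arcs u
  | inl (inr v), inr y => v \in snk G y
  | _, _ => false
  end.

(** Its strict growth along edges yields both acyclicity and the depth bound. *)
Definition net_rank (t : T) : nat :=
  match t with
  | inl (inl _) => 0
  | inl (inr v) => (level v).+1
  | inr _ => b.+1
  end.

Lemma net_rank_edge s t : net_edge s t -> net_rank s < net_rank t.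
Proof.
case: s t => [[x|u]|y] [[x'|v]|y'] //=; first by rewrite ltnS => /level_arcs.
by rewrite !ltnS => _; apply: level_lt.
Qed.

Lemma net_rank_path s p : path net_edge s p -> net_rank s + size p <= net_rank (last s p).
Proof.
elim: p s => [|t p IHp] s /=; first by rewrite addn0.
move=> /andP[/net_rank_edge lt_st /IHp]; apply: leq_trans.
by rewrite addnS -addSn leq_add2r.
Qed.

Lemma net_acyclic c : cycle net_edge c -> c = [::].
Proof.
case: c => // s p /net_rank_path; rewrite last_rcons size_rcons => le.
by move: le; rewrite addnS ltnNge leq_addr.
Qed.

Definition net_inputs : {set T} := [set inl (inl x) | x : I].
Definition net_outputs : {set T} := [set inr y | y : O].

Lemma net_card_inputs : #|net_inputs| = m.
Proof. by rewrite card_imset ?cardI // => x y [->]. Qed.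

Lemma net_card_outputs : #|net_outputs| = n.
Proof. by rewrite card_imset ?cardO // => x y [->]. Qed.

Lemma net_disjoint : [disjoint net_inputs & net_outputs].
Proof.
rewrite -setI_eq0; apply/eqP/setP => t; rewrite !inE; apply/negP.
by case/andP => /imsetP[x _ ->] /imsetP[].
Qed.

Definition net : network m n :=
  @Network m n T net_edge net_inputs net_outputs
    net_acyclic net_card_inputs net_card_outputs net_disjoint.

Lemma net_num_edges : num_edges net = gadget_cost G.
Proof.
rewrite /num_edges card_rel /= !big_sumType /= /gadget_cost.
rewrite [X in _ + X]big1 => [|y _]; last first.
  by apply: eq_card0 => t; rewrite !inE; case: t => [[]|].
rewrite addn0 -addnA; congr (_ + _).
  apply: eq_bigr => x _; rewrite !card_set_sum.
  rewrite [X in _ + X]eq_card0 => [|y]; last by rewrite !inE.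
  rewrite [X in X + _ + _]eq_card0 => [|y]; last by rewrite !inE.
  by rewrite add0n addn0; apply: eq_card => v; rewrite !inE.
(* [gadget_cost] counts the edges into outputs at their heads, [num_edges] at their tails; double
   counting reconciles the two. *)
rewrite -[X in _ = _ + X](eq_bigr _ (fun y _ =>
  eq_card (fun v => in_set (mem (snk G y)) v))).
rewrite -card_rel_sym -big_split /=; apply: eq_bigr => u _; rewrite !card_set_sum.
rewrite [X in X + _ + _]eq_card0 => [|y]; last by rewrite !inE.
by congr (_ + _); apply: eq_card => v; rewrite !inE.
Qed.

Lemma net_depth : depth net <= b.+1.
Proof.
apply/depth_leqP => x p /imsetP[i _ ->] /net_rank_path le_p /imsetP[y _ lastp].
by move: le_p; rewrite lastp add0n.
Qed.

Hypothesis robustG : forall j, robust G j.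

Section Linking.

Variables X Y : {set T}.
Hypotheses (XI : X \subset net_inputs) (YO : Y \subset net_outputs).
Hypothesis cardXY : #|X| = #|Y|.

Let is_inner (t : T) := if t is inl (inr _) then true else false.
Let D := X :|: [set t | is_inner t].

(* A matching that saturates [D] is a system of disjoint paths: inner vertices
   matched to themselves are off the paths. *)
Let succ_or_idle (s : T) : {set T} :=
  [set t | is_inner s && (t == s)
           || net_edge s t && (is_inner t || (t \in Y))].

Lemma card_set_net (Z : {set T}) :
  #|Z| = #|[set x : I | inl (inl x) \in Z]| + #|[set v | inl (inr v) \in Z]|
         + #|[set y : O | inr y \in Z]|.
Proof.
rewrite !card_set_sum; congr (_ + _ + _).
all: by apply: eq_card => z; rewrite !inE.
Qed.

(** Suppose that [Z] violates Hall's condition. As [Zv] lies in [Hv], the set [Hv :\: Zv] is smaller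
    than both [Zx] and [Yy :\: Hy]. Robustness gives a path between these two sets that avoids it.
    Such a path never leaves [Z], so its output is in [Hy], a contradiction. *)
Lemma hall_succ_or_idle (Z : {set T}) :
  Z \subset D -> #|Z| <= #|hood succ_or_idle Z|.
Proof.
move=> /subsetP ZD; set H := hood _ _; rewrite leqNgt; apply/negP => ltHZ.
have inZ (y : O) : inr y \notin Z.
  apply/negP => /ZD; rewrite !inE orbF => /(subsetP XI)/imsetP[] //.
have inY (t : I + inner G) : inl t \notin Y.
  by apply/negP => /(subsetP YO)/imsetP[].
pose Zx := [set x : I | inl (inl x) \in Z]; pose Zv := [set v | inl (inr v) \in Z].
pose Hv := [set v | inl (inr v) \in H]; pose Hy := [set y : O | inr y \in H].
pose Yy := [set y : O | inr y \in Y].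
have cardZ : #|Z| = #|Zx| + #|Zv|.
  rewrite card_set_net [X in _ + X]eq_card0 ?addn0 // => y.
  by rewrite inE (negbTE (inZ y)).
have leHH : #|Hv| + #|Hy| <= #|H| by rewrite (card_set_net H) leq_add2r leq_addl.
have cardY : #|Yy| = #|X|.
  rewrite cardXY (card_set_net Y) [X in X + _ + _]eq_card0 => [|x].
    rewrite [X in X + _]eq_card0 // => v.
    by rewrite inE (negbTE (inY _)).
  by rewrite inE (negbTE (inY _)).
have leZX : #|Zx| <= #|X|.
  rewrite (card_set_net X) -addnA; apply: leq_trans (leq_addr _ _).
  apply/subset_leq_card/subsetP => x; rewrite !inE => /ZD.
  by rewrite !inE orbF.
have HyY : Hy \subset Yy.
  apply/subsetP => y; rewrite !inE => /hoodP[t _]; rewrite inE.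
  by case: t => [[]|] //= ?; rewrite ?andbF ?orbF //= => /andP[].
have ZvH : Zv \subset Hv.
  apply/subsetP => v; rewrite !inE => vZ; apply/hoodP; exists (inl (inr v)) => //.
  by rewrite inE /= eqxx.
have cardS := cardsD Hv Zv; rewrite (setIidPr ZvH) in cardS.
have cardY2 := cardsD Yy Hy; rewrite (setIidPr HyY) in cardY2.
have le1 := subset_leq_card ZvH; have le2 := subset_leq_card HyY.
have [||//|x [y [u [xZ yY ux]]]] :=
  robustG (j := #|Hv :\: Zv|.+1) (X := Zx) (Y := Yy :\: Hy) (S := Hv :\: Zv).
- by lia.
- by lia.
have step v w : inl v \in Z -> net_edge (inl v) (inl (inr w)) ->
    w \notin Hv :\: Zv -> inl (inr w) \in Z.
  move=> vZ vw; rewrite !inE; have [//|/= _] := boolP (inl (inr w) \in Z).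
  case/negP; apply/hoodP; exists (inl v) => //.
  by rewrite inE vw orbT.
move=> uy; have : inl (inr u) \in Z.
  by apply: (step (inl x) _ _ _ (reach_notin uy)); move: xZ; rewrite ?inE.
move: yY; rewrite !inE => /andP[yH yY].
elim: uy => [v _ vy vZ|v w vS vw wy IH vZ].
  case/negP: yH; apply/hoodP; exists (inl (inr v)); first by [].
  by rewrite inE /= vy yY ?orbT.
by apply: IH; apply: (step (inr v) _ _ _ (reach_notin wy)); move: vZ; rewrite ?inE.
Qed.

Lemma linking_exists : exists P : 'I_#|X| -> seq T,
  (forall i, path_between (G := net) X Y (P i)) /\
  (forall i j, i != j -> [disjoint P i & P j]).
Proof.
have [X0|[x0 x0X]] := set_0Vmem X.
  exists (fun=> [::]); rewrite X0 cards0; split=> [[]|[]] //.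
have [f fI fE] := hall x0 hall_succ_or_idle.
pose next := [rel s t | [&& s \in D, net_edge s t & f s == t]].
have edge_irr t : net_edge t t = false.
  by apply/negP => /net_rank_edge; rewrite ltnn.
have next_out s : s \in D -> f s != s ->
    net_edge s (f s) && (is_inner (f s) || (f s \in Y)).
  move=> sD fs; have := fE s sD; rewrite inE (negbTE fs) andbF /=; exact.
(* By injectivity of [f], the inner successor of a vertex that moves also moves. The rank is
   bounded, so the walk stops, and it can stop only in [Y]. *)
have to_outputs s : s \in D -> f s != s -> exists2 p, path next s p & last s p \in Y.
  move: {2}(b.+2 - net_rank s) (leqnn (b.+2 - net_rank s)) => k.
  elim: k s => [|k IHk] s lek sD fs; have /andP[sfs fsY] := next_out s sD fs.
    have := net_rank_edge sfs; have : net_rank (f s) <= b.+1.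
      by case: (f s) => [[|v]|] //=; have := level_lt v; lia.
    by lia.
  have [fsYt|fsYf] := boolP (f s \in Y); first by exists [:: f s]; rewrite //= sD sfs eqxx.
  rewrite (negbTE fsYf) orbF in fsY.
  have fsD : f s \in D by rewrite !inE fsY orbT.
  have [||p pp pY] := IHk (f s) _ fsD.
  - by have := net_rank_edge sfs; lia.
  - by apply/eqP => /fI; move=> /(_ fsD sD)/eqP; rewrite (negbTE fs).
  by exists (f s :: p); rewrite //= sD sfs eqxx.
have /fin_all_exists[p pP] (i : 'I_#|X|) : exists p,
    path next (enum_val i) p && (last (enum_val i) p \in Y).
  have xX := enum_valP i; have xD : enum_val i \in D by rewrite inE xX.
  have /imsetP[x _ xE] := subsetP XI _ xX.
  have [|p pp pY] := to_outputs (enum_val i) xD; last by exists p; rewrite pp.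
  by apply/eqP => ffix; have := fE _ xD; rewrite ffix inE edge_irr xE.
exists (fun i => enum_val i :: p i); split=> [i|i j].
  have /andP[pp pY] := pP i; rewrite /= enum_valP pY andbT /=.
  by apply: sub_path pp => s t /and3P[].
apply: contraR => /pred0Pn[t /andP[/= ti tj]]; apply/eqP.
have prefix_to k : t \in enum_val k :: p k ->
    exists2 q, path next (enum_val k) q & last (enum_val k) q = t.
  move=> tk; have /andP[pp _] := pP k.
  case/splitPl: tk pp => q1 q2 <-; rewrite cat_path => /andP[pq _].
  by exists q1.
have [qi pi li] := prefix_to i ti; have [qj pj lj] := prefix_to j tj.
have no_pred s x : x \in X -> ~~ next s x.
  move=> /(subsetP XI)/imsetP[y _ ->].
  by case: s => [[]|] * /=; rewrite andbF.
apply: enum_val_inj; have : last (enum_val i) qi = last (enum_val j) qj by rewrite lj.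
clear li lj ti tj.
(* Two paths with a common vertex are traced back in step, by injectivity of [f]. Inputs have no
   predecessor, so both traces reach their starts together. *)
elim/last_ind: qi qj pi pj => [|qi s IH] qj; case/lastP: qj => [|qj t'] //.
- rewrite rcons_path => _ /andP[_ nx]; rewrite last_rcons /= => eqx.
  by case/negP: (no_pred (last (enum_val j) qj) _ (enum_valP i)); rewrite eqx.
- rewrite rcons_path => /andP[_ nx] _; rewrite last_rcons /= => eqx.
  by case/negP: (no_pred (last (enum_val i) qi) _ (enum_valP j)); rewrite -eqx.
rewrite !rcons_path !last_rcons => /andP[pi /and3P[D1 _ /eqP f1]].
move=> /andP[pj /and3P[D2 _ /eqP f2]] eqs; apply: (IH qj) => //.
by apply: fI => //; rewrite f1 f2.
Qed.

End Linking.

Lemma net_superconcentrator : superconcentrator net.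
Proof. by move=> X Y; apply: linking_exists. Qed.

End GadgetNetwork.

(** * Random bipartite graphs *)

Lemma subset_of_card (T : finType) (X : {set T}) j :
  j <= #|X| -> exists2 X0 : {set T}, X0 \subset X & #|X0| = j.
Proof.
rewrite -bin_gt0 -cards_draws card_gt0 => /set0Pn[X0].
by rewrite inE => /andP[sub /eqP card]; exists X0.
Qed.

Lemma bin_leq_exp2 m k : 'C(m, k) <= 2 ^ m.
Proof.
rewrite -[m]card_ord -cardsT -cards_draws -card_powerset.
apply: subset_leq_card; apply/subsetP => A; rewrite !inE => /andP[-> _] //.
Qed.

Lemma ffact_leq_exp m k : m ^_ k <= m ^ k.
Proof.
rewrite ffact_prod -[k in leqRHS]card_ord -prod_nat_const.
by apply: leq_prod => i _; apply: leq_subr.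
Qed.

(** The bound $\binom mk\le(em/k)^k$ with 4 in place of $e$ and no division, from
    $k^k\le(2k)!/k!=\binom{2k}{k}k!\le4^kk!$. *)
Lemma bin_leq_div m k : 'C(m, k) * k ^ k <= (4 * m) ^ k.
Proof.
have le_ffact : k ^ k <= (k + k) ^_ k.
  have -> : k ^ k = \prod_(i < k) k by rewrite prod_nat_const card_ord.
  rewrite ffact_prod.
  by apply: leq_prod => i _; have := ltn_ord i; lia.
have le_fact : k ^ k <= 4 ^ k * k`!.
  apply: leq_trans le_ffact _; rewrite -bin_ffact leq_mul2r -[4]/(2 ^ 2) -expnM.
  by rewrite mul2n -addnn bin_leq_exp2 orbT.
apply: leq_trans (_ : 'C(m, k) * (4 ^ k * k`!) <= _); first by rewrite leq_mul2l le_fact orbT.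
by rewrite mulnCA bin_ffact expnMn leq_mul2l ffact_leq_exp orbT.
Qed.

Section Random.

Variables n N D : nat.
Implicit Types (X : {set 'I_n}) (T : {set 'I_N}).

Let sample : finType := {ffun 'I_n * 'I_D -> 'I_N}.
Let nbhd (F : sample) (x : 'I_n) : {set 'I_N} := [set F (x, d) | d : 'I_D].

Lemma card_trapped X T :
  #|[set F : sample | hood (nbhd F) X \subset T]|
    = #|T| ^ (#|X| * D) * N ^ ((n - #|X|) * D).
Proof.
pose Q (p : 'I_n * 'I_D) : {set 'I_N} := if p.1 \in X then T else setT.
have -> : #|[set F : sample | hood (nbhd F) X \subset T]| = #|family (fun p => mem (Q p))|.
  apply: eq_card => F; rewrite inE; apply/subsetP/familyP => [sub [x d]|Fam z].
    rewrite /Q /=; case: ifP => [xX|_]; last exact: in_setT.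
    apply: sub; apply/hoodP; exists x => //.
    exact: imset_f.
  case/hoodP => x xX /imsetP[d _ ->]; have := Fam (x, d).
  by rewrite /Q /= xX.
rewrite card_family foldrE big_map big_enum /=.
rewrite -(pair_bigA _ (fun x d => #|Q (x, d)|)) /= (bigID (mem X)) /=.
congr (_ * _).
  rewrite (eq_bigr (fun=> #|T| ^ D)) => [|x xX].
    by rewrite prod_nat_const -expnM mulnC.
  by rewrite /Q /= xX prod_nat_const card_ord.
rewrite (eq_bigr (fun=> N ^ D)) => [|x /negbTE xX].
  rewrite prod_nat_const -expnM mulnC; congr (_ ^ (_ * _)).
  have := cardsCs (~: X); rewrite setCK card_ord => <-.
  by apply: eq_card => x; rewrite !inE.
by rewrite /Q /= xX cardsT prod_nat_const !card_ord.
Qed.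

(** Union bound by counting: the sum bounds the number of samples in which, for some [j], a set of
    [j] points has its hood inside a set of [t j] points. Any other sample will do. *)
Lemma random_nbhd (s : seq nat) (t : nat -> nat) :
  \sum_(j <- s) 'C(n, j) * 'C(N, t j) * (t j ^ (j * D) * N ^ ((n - j) * D))
    < N ^ (n * D) ->
  exists nb : 'I_n -> {set 'I_N}, (forall x, #|nb x| <= D) /\
    (forall j X, j \in s -> t j <= N -> j <= #|X| -> t j < #|hood nb X|).
Proof.
pose trapped F j X T := [&& #|X| == j, #|T| == t j & hood (nbhd F) X \subset T].
have [/existsP[F /allP goodF] _|/existsPn bad] :=
    boolP [exists F, all (fun j => [forall X, forall T, ~~ trapped F j X T]) s].
  exists (nbhd F); split=> [x|j X js jN jX].
    by apply: leq_trans (leq_imset_card _ _) _; rewrite card_ord.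
  have [X0 X0X X0j] := subset_of_card jX; rewrite ltnNge; apply/negP => le.
  have le0 : #|hood (nbhd F) X0| <= t j.
    exact: leq_trans (subset_leq_card (hoodS _ X0X)) le.
  (* A hood that is too small is padded to exactly [t j] points, as the complement of [T0]. *)
  have [T0] : exists2 T0 : {set 'I_N}, T0 \subset ~: hood (nbhd F) X0 & #|T0| = N - t j.
    by apply: subset_of_card; rewrite cardsCs setCK card_ord leq_sub2l.
  move=> T0h cT0; have /forallP/(_ X0)/forallP/(_ (~: T0))/negP[] := goodF j js.
  rewrite /trapped X0j eqxx cardsCs setCK card_ord cT0 subKn // eqxx /=.
  by rewrite -disjoints_subset disjoint_sym disjoints_subset.
rewrite ltnNge => /negP[].
have -> : N ^ (n * D) = #|sample| by rewrite card_ffun card_prod !card_ord.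
rewrite -sum1_card.
apply: leq_trans (_ : \sum_F \sum_(j <- s) \sum_X \sum_T (trapped F j X T : nat) <= _).
  apply: leq_sum => F _; have /allPn[j js /forallPn[X /forallPn[T]]] := bad F.
  rewrite negbK => tr; rewrite (big_rem j js) (bigD1 X) // (bigD1 T) //= tr.
  by rewrite -!addnA leq_addr.
rewrite exchange_big /=; apply: leq_sum => j _; rewrite exchange_big /=.
rewrite -[n in 'C(n, j)]card_ord -[N in 'C(N, t j)]card_ord -!card_draws.
rewrite -mulnA -sum_nat_const.
rewrite (bigID (fun X => #|X| == j)) /= [X in _ + X]big1 => [|X /negbTE Xj]; last first.
  by apply: big1 => F _; apply: big1 => T _; rewrite /trapped Xj.
rewrite addn0 leq_eqVlt; apply/orP; left; apply/eqP; apply: eq_big => // [X|X /eqP Xj].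
  by rewrite inE.
rewrite exchange_big /= -sum_nat_const.
rewrite (bigID (fun T => #|T| == t j)) /= [X in _ + X]big1 => [|T /negbTE Tj]; last first.
  by apply: big1 => F _; rewrite /trapped Tj andbF.
rewrite addn0; apply: eq_big => [T|T /eqP Tj]; first by rewrite inE.
have := card_trapped X T; rewrite Xj Tj => <-; rewrite -sum1_card [RHS]big_mkcond /=.
by apply: eq_bigr => F _; rewrite /trapped Xj Tj !eqxx inE /=; case: ifP.
Qed.

End Random.

Lemma sum_geometric_lt (a : nat -> nat) M J :
  0 < M -> (forall j, 0 < j <= J -> 2 ^ j * a j <= M) ->
  \sum_(1 <= j < J.+1) a j < M.
Proof.
(* This says that the sum is at most $M(1-2^{-J})$. *)
move=> M0 le_a; suff: 2 ^ J * (\sum_(1 <= j < J.+1) a j) + M <= 2 ^ J * M.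
  by have := expn_gt0 2 J; nia.
elim: J le_a => [|J IHJ] le_a; first by rewrite big_geq // muln0 mul1n.
rewrite big_nat_recr //=; have := le_a J.+1; rewrite leqnn => /(_ isT).
have : 2 ^ J * (\sum_(1 <= j < J.+1) a j) + M <= 2 ^ J * M.
  by apply: IHJ => j jJ; apply: le_a; lia.
by rewrite expnS; move: (2 ^ J) (bigop _ _ _) (a _) => P Q R; lia.
Qed.

(** The proportion of bad samples for size $j$ is at most
    $((4n/j)(4N/2j)^2(2j/N)^{e+3})^j=(128\,n(2j)^e/N^{e+1})^j$. Three of the $e+3$ choices pay for
    the binomials, and the hypothesis makes the bound at most $2^{-j}$. *)
Lemma expander_exists n N J e :
  256 * n * (2 * J) ^ e <= N ^ e.+1 ->
  exists nb : 'I_n -> {set 'I_N}, (forall x, #|nb x| <= e + 3) /\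
    (forall j (X : {set 'I_n}), j <= J -> j <= #|X| -> 2 * j <= #|hood nb X|).
Proof.
move=> leN; have [N0|N_gt0] := posnP N.
  exists (fun=> set0); split=> [x|j X jJ jX]; first by rewrite cards0.
  have jn : j <= n by apply: leq_trans jX _; rewrite -[leqRHS]card_ord max_card.
  have [->|j0] := posnP j; first by rewrite muln0.
  move: leN; rewrite N0 exp0n // leqn0 !muln_eq0 expn_eq0 muln_eq0 /=.
  by case/orP => [/eqP n0|/andP[/eqP J0 _]]; lia.
have leNj j : j <= J -> 256 * n * (2 * j) ^ e <= N ^ e.+1.
  move=> jJ; apply: leq_trans leN; rewrite leq_mul2l.
  by apply/orP; right; case: (e) => // k; rewrite leq_exp2r // leq_mul2l jJ orbT.
have [|nb [nbD nbH]] := @random_nbhd n N (e + 3) (index_iota 1 J.+1) (fun j => 2 * j).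
  apply: sum_geometric_lt => [|j /andP[j0 jJ]]; first by rewrite expn_gt0 N_gt0.
  have [lejn|ltnj] := leqP j n; last by rewrite bin_small // !mul0n muln0.
  have -> : N ^ (n * (e + 3)) = N ^ (j * (e + 3)) * N ^ ((n - j) * (e + 3)).
    by rewrite -expnD -mulnDl subnKC.
  rewrite !mulnA leq_mul2r; apply/orP; right.
  have pos : 0 < j ^ j * (2 * j) ^ (2 * j) by rewrite muln_gt0 !expn_gt0 j0 ?muln_gt0 ?j0.
  rewrite -(leq_pmul2r pos).
  apply: leq_trans (_ : 2 ^ j * ((4 * n) ^ j * (4 * N) ^ (2 * j))
      * (2 * j) ^ (j * (e + 3)) <= _).
    have := leq_mul (leqnn (2 ^ j * (2 * j) ^ (j * (e + 3))))
      (leq_mul (bin_leq_div n j) (bin_leq_div N (2 * j))).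
    move: 'C(n, j) 'C(N, _) (j ^ j) (_ ^ (2 * j)) (_ ^ (j * _)) (2 ^ j).
    by move: ((4 * n) ^ j) ((4 * N) ^ (2 * j)) => *; lia.
  have -> : 2 ^ j * ((4 * n) ^ j * (4 * N) ^ (2 * j)) * (2 * j) ^ (j * (e + 3))
      = (2 * (4 * n * (4 * N) ^ 2) * (2 * j) ^ (e + 3)) ^ j.
    rewrite [RHS]expnMn [X in _ = X * _]expnMn [X in _ = _ * X * _]expnMn.
    by rewrite -!expnM (mulnC j).
  have -> : N ^ (j * (e + 3)) * (j ^ j * (2 * j) ^ (2 * j))
      = (N ^ (e + 3) * (j * (2 * j) ^ 2)) ^ j.
    by rewrite [RHS]expnMn [X in _ = _ * X]expnMn -!expnM (mulnC j (e + 3)).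
  rewrite leq_exp2r // addnC !expnD; have := leNj j jJ; rewrite expnS.
  rewrite -(leq_pmul2r (_ : 0 < N ^ 2 * j ^ 3)) ?muln_gt0 ?expn_gt0 ?N_gt0 ?j0 //.
  by move: ((2 * j) ^ e) (N ^ e) => P Q; rewrite !expnS !expn0; lia.
(* It remains to see that $2j\le N$: otherwise $N<2j\le2n$ contradicts the hypothesis. *)
exists nb; split=> // -[//|j] X jJ jX; apply: ltnW; apply: nbH => //.
  by rewrite mem_index_iota.
have leJ := leNj _ jJ.
have jn : j.+1 <= n by apply: leq_trans jX _; rewrite -[leqRHS]card_ord max_card.
rewrite leqNgt; apply/negP => ltN; move: leJ; rewrite expnS.
have : N ^ e <= (2 * j.+1) ^ e by case: (e) => // k; rewrite leq_exp2r // ltnW.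
have : 0 < N ^ e by rewrite expn_gt0 N_gt0.
by move: (_ ^ e) (_ ^ e) => Q P; nia.
Qed.

(** Two hoods of more than [5 * j0] points among [8 * j0] share more than [2 * j0]. Per element of
    the small set, the binomials cost at most $2^{i+2}\cdot2^8$, and the degree is chosen so that
    $(5/8)^D$ outweighs this. *)
Lemma disperser_exists n j0 i :
  0 < j0 -> n <= j0 * 2 ^ i ->
  exists nb : 'I_n -> {set 'I_(8 * j0)},
    (forall x, #|nb x| <= 2 * (i + 11)) /\
    (forall X : {set 'I_n}, j0 <= #|X| -> 5 * j0 < #|hood nb X|).
Proof.
move=> j0_gt0 len; move DE: (2 * (i + 11)) => D.
have [|nb [nbD nbH]] := @random_nbhd n (8 * j0) D [:: j0] (fun j => 5 * j); last first.
  by exists nb; split=> // X jX; apply: nbH; rewrite ?mem_head // leq_mul2r orbT.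
rewrite big_seq1; have [lejn|ltnj] := leqP j0 n; last first.
  by rewrite bin_small // !mul0n expn_gt0 muln_gt0 j0_gt0.
have -> : (8 * j0) ^ (n * D) = (8 * j0) ^ (j0 * D) * (8 * j0) ^ ((n - j0) * D).
  by rewrite -expnD -mulnDl subnKC.
rewrite !mulnA ltn_pmul2r; last by rewrite expn_gt0 muln_gt0 j0_gt0.
rewrite [(5 * _) ^ _]expnMn [(8 * _) ^ (j0 * D)]expnMn mulnA.
rewrite ltn_pmul2r; last by rewrite expn_gt0 j0_gt0.
have le_bin : 'C(n, j0) <= (2 ^ (i + 2)) ^ j0.
  rewrite -(leq_pmul2r (_ : 0 < j0 ^ j0)) ?expn_gt0 ?j0_gt0 //.
  apply: leq_trans (bin_leq_div n j0) _; rewrite -expnMn leq_exp2r //.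
  by rewrite expnD; move: (2 ^ i) len => P; lia.
have le_bin2 : 'C(8 * j0, 5 * j0) <= (2 ^ 8) ^ j0.
  by rewrite -expnM bin_leq_exp2.
apply: leq_ltn_trans (_ : (2 ^ (i + 2) * 2 ^ 8 * 5 ^ D) ^ j0 < _).
  rewrite [leqRHS]expnMn [X in _ <= X * _]expnMn -(expnM 5) (mulnC D).
  by apply: leq_mul => //; apply: leq_mul.
rewrite (mulnC j0) expnM ltn_exp2r // -expnD.
apply: leq_trans (_ : 2 ^ (i + 11) * 5 ^ D <= _).
  by rewrite ltn_mul2r expn_gt0 ltn_exp2l //=; lia.
(* Two choices gain a factor 2, since $2\cdot5^2\le8^2$. *)
by rewrite -DE !expnM -expnMn leq_exp2r // addnC.
Qed.

(** * Combining gadgets *)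

Definition sum_set (A B : finType) (X : {set A}) (Y : {set B}) : {set A + B} :=
  [set u | match u with inl a => a \in X | inr b => b \in Y end].

Lemma card_sum_set (A B : finType) (X : {set A}) (Y : {set B}) :
  #|sum_set X Y| = #|X| + #|Y|.
Proof. by rewrite card_set_sum; congr (_ + _); apply: eq_card => z; rewrite !inE. Qed.

(** The last premise asks for [reach] in [G'], not for an arc to the output, so that the image of a
    path may be prolonged. *)
Lemma reach_map (I O O' : finType) (G : gadget I O) (I' : finType)
    (G' : gadget I' O') (f : inner G -> inner G')
    (S : {set inner G}) (S' : {set inner G'}) y y' :
  (forall v, v \notin S -> f v \notin S') ->
  (forall v w, w \in arcs v -> f w \in arcs (f v)) ->
  (forall v, v \in snk G y -> v \notin S -> reach S' y' (f v)) ->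
  forall v, reach S y v -> reach S' y' (f v).
Proof.
move=> fS farc fsnk v; elim=> [{}v vS vy|{}v w vS vw _ IH]; first exact: fsnk.
by apply: reach_arcs IH; [exact: fS | exact: farc].
Qed.

Definition realizable (I O : finType) (b c : nat) (Q : nat -> Prop) : Prop :=
  exists G : gadget I O,
    [/\ forall v : inner G, level v < b, gadget_cost G <= c
      & forall j, Q j -> robust G j].

Section Constructions.

Variables I O : finType.

(** Robustness is vacuous for [j = 0] and when there are fewer than [j] inputs or outputs, hence the
    restricted implication. *)
Lemma realizable_weaken b c Q b' c' (Q' : nat -> Prop) :
  b <= b' -> c <= c' -> (forall j, 0 < j -> j <= #|I| -> j <= #|O| -> Q' j -> Q j) ->
  realizable I O b c Q -> realizable I O b' c' Q'.
Proof.
move=> leb lec QQ [G [Gl Gc Gr]]; exists G; split=> [v||[|j] Q'j X Y S jX jY] //.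
- exact: leq_trans (Gl v) leb.
- exact: leq_trans Gc lec.
apply: (Gr j.+1) => //; apply: QQ => //.
  exact: leq_trans jX (max_card _).
exact: leq_trans jY (max_card _).
Qed.

Lemma realizable_layer M D (nbI : I -> {set M}) (nbO : O -> {set M}) :
  (forall x, #|nbI x| <= D) -> (forall y, #|nbO y| <= D) ->
  realizable I O 1 ((#|I| + #|O|) * D) (fun j => forall (X : {set I}) (Y : {set O}),
    j <= #|X| -> j <= #|Y| -> j <= #|hood nbI X :&: hood nbO Y|).
Proof.
move=> leI leO.
have levP (u v : M) : v \in set0 -> 0 < 0 by rewrite inE.
exists (@Gadget I O M nbI (fun=> set0) nbO (fun=> 0) levP); split=> [//||j big X Y S jX jY jS].
  rewrite /gadget_cost [X in _ + X + _]big1 => [|v _]; last by rewrite cards0.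
  rewrite addn0 mulnDl -![_ * D]sum_nat_const.
  by rewrite leq_add // leq_sum.
have [v] : exists v, v \in (hood nbI X :&: hood nbO Y) :\: S.
  apply/set0Pn; rewrite -card_gt0 cardsD subn_gt0.
  apply: leq_ltn_trans (subset_leq_card (subsetIr _ _)) _.
  by apply: leq_trans jS _; apply: big.
rewrite !inE => /andP[vS /andP[/hoodP[x xX vx] /hoodP[y yY vy]]].
by exists x, y, v; split=> //; apply: reach_snk.
Qed.

Lemma realizable_empty b c (Q : nat -> Prop) :
  (forall j, 0 < j -> j <= #|I| -> ~ Q j) -> realizable I O b c Q.
Proof.
move=> Q0; apply: (@realizable_weaken b c (fun j => j = 0)) => //.
  by move=> j j0 jI _ /Q0[].
exists (@Gadget I O void (fun=> set0) (fun=> set0) (fun=> set0) (fun=> 0)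
  (fun u => match u with end)); split=> [[]||_ ->] //.
by rewrite /gadget_cost !big1 // => *; rewrite cards0.
Qed.

Lemma realizable_union b c1 Q1 c2 Q2 :
  realizable I O b c1 Q1 -> realizable I O b c2 Q2 ->
  realizable I O b (c1 + c2) (fun j => Q1 j \/ Q2 j).
Proof.
move=> [G [Gl Gc Gr]] [H [Hl Hc Hr]].
pose arcU (u : inner G + inner H) : {set inner G + inner H} :=
  match u with inl u => sum_set (arcs u) set0 | inr u => sum_set set0 (arcs u) end.
pose levU (u : inner G + inner H) := match u with inl u => level u | inr u => level u end.
have levP u v : v \in arcU u -> levU u < levU v.
  by case: u v => u [] v; rewrite inE ?inE //; apply: level_arcs.
pose U := @Gadget I O (inner G + inner H)%type
  (fun x => sum_set (src G x) (src H x)) arcU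
  (fun y => sum_set (snk G y) (snk H y)) levU levP.
exists U; split=> [[]||j [/Gr|/Hr] rob X Y S jX jY jS] //.
- rewrite /gadget_cost big_sumType /=.
  under eq_bigr do rewrite card_sum_set.
  under [X in _ + (X + _) + _]eq_bigr do rewrite card_sum_set cards0 addn0.
  under [X in _ + (_ + X) + _]eq_bigr do rewrite card_sum_set cards0 add0n.
  under [X in _ + X]eq_bigr do rewrite card_sum_set.
  by rewrite !big_split /=; move: Gc Hc; rewrite /gadget_cost; lia.
- have [|x [y [u [xX yY ux uy]]]] := rob X Y [set u | inl u \in S] jX jY.
    by apply: leq_ltn_trans jS; rewrite [leqRHS]card_set_sum leq_addr.
  exists x, y, (inl u); split=> //; first by rewrite inE.
  apply: reach_map uy => [v|v w vw|v vy]; rewrite ?inE // => vS.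
  by apply: reach_snk; rewrite ?inE.
- have [|x [y [u [xX yY ux uy]]]] := rob X Y [set u | inr u \in S] jX jY.
    by apply: leq_ltn_trans jS; rewrite [leqRHS]card_set_sum leq_addl.
  exists x, y, (inr u); split=> //; first by rewrite inE.
  apply: reach_map uy => [v|v w vw|v vy]; rewrite ?inE // => vS.
  by apply: reach_snk; rewrite ?inE.
Qed.

(** Doubling pays for the cut: after fewer than [j] deletions at least [j] of the [2 * j] neighbours
    survive on either side, and robustness of the middle gadget joins the survivors. *)
Lemma realizable_sandwich (M N : finType) D (nbI : I -> {set M})
    (nbO : O -> {set N}) b c Q :
  (forall x, #|nbI x| <= D) -> (forall y, #|nbO y| <= D) ->
  realizable M N b c Q ->
  realizable I O b.+2 ((#|I| + #|O|) * D + c) (fun j =>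
    [/\ Q j, forall X : {set I}, j <= #|X| -> 2 * j <= #|hood nbI X|
      & forall Y : {set O}, j <= #|Y| -> 2 * j <= #|hood nbO Y|]).
Proof.
move=> leI leO [G [Gl Gc Gr]].
pose V : finType := (M + inner G + N)%type.
pose arcsV (u : V) : {set V} := match u with
  | inl (inl z) => sum_set (sum_set set0 (src G z)) set0
  | inl (inr v) => sum_set (sum_set set0 (arcs v)) [set y | v \in snk G y]
  | inr _ => set0 end.
pose levV (u : V) := match u with
  | inl (inl z) => 0 | inl (inr v) => (level v).+1 | inr _ => b.+1 end.
have levP u v : v \in arcsV u -> levV u < levV v.
  case: u v => [[z|u]|y] [[z'|v]|y'] //=; rewrite ?inE // ?ltnS; first exact: level_arcs.
  by move=> _; apply: Gl.
pose U := @Gadget I O V (fun x => sum_set (sum_set (nbI x) set0) set0) arcsV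
  (fun y => sum_set set0 (nbO y)) levV levP.
exists U; split=> [[[z|v]|y]||j [Qj expI expO] X Y S jX jY jS] //=.
- by rewrite !ltnS ltnW // Gl.
- rewrite /gadget_cost !big_sumType /=.
  have -> : \sum_x #|sum_set (sum_set (nbI x) (@set0 (inner G))) (@set0 N)|
      = \sum_x #|nbI x|.
    by apply: eq_bigr => x _; rewrite !card_sum_set !cards0 !addn0.
  have -> : \sum_y #|sum_set (@set0 (M + inner G)%type) (nbO y)| = \sum_y #|nbO y|.
    by apply: eq_bigr => y _; rewrite card_sum_set cards0.
  have -> : \sum_z #|sum_set (sum_set (@set0 M) (src G z)) (@set0 N)|
      = \sum_z #|src G z|.
    by apply: eq_bigr => z _; rewrite !card_sum_set !cards0 addn0.
  have -> : \sum_v #|sum_set (sum_set (@set0 M) (arcs v)) [set y | v \in snk G y]|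
      = \sum_(v : inner G) #|arcs v| + \sum_y #|snk G y|.
    rewrite (eq_bigr (fun v : inner G => #|arcs v| + #|[set y | v \in snk G y]|)).
      rewrite big_split card_rel_sym /=; congr (_ + _).
      by apply: eq_bigr => y _; apply: eq_card => v; rewrite inE.
    by move=> v _; rewrite !card_sum_set cards0.
  rewrite [X in _ + (_ + X) + _]big1 => [|y _]; last by rewrite cards0.
  rewrite addn0 addnAC mulnDl -![_ * D]sum_nat_const.
  apply: leq_add; last by rewrite addnA; exact: Gc.
  by apply: leq_add; apply: leq_sum.
pose SM := [set z : M | inl (inl z) \in S]; pose SN := [set z : N | inr z \in S].
pose SG := [set v : inner G | inl (inr v) \in S].
have leS : #|SM| + #|SG| + #|SN| <= #|S|.
  rewrite [leqRHS]card_set_sum [X in _ <= X + _]card_set_sum.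
  by apply: eq_leq; congr (_ + _ + _); apply: eq_card => z; rewrite !inE.
have [|||x [y [u [xX yY ux uy]]]] :=
  Gr j Qj (hood nbI X :\: SM) (hood nbO Y :\: SN) SG.
- have := subset_leq_card (subsetIr (hood nbI X) SM); have := expI X jX.
  by rewrite cardsD; lia.
- have := subset_leq_card (subsetIr (hood nbO Y) SN); have := expO Y jY.
  by rewrite cardsD; lia.
- by lia.
move: xX yY; rewrite !inE => /andP[xS /hoodP[x0 x0X xx0]] /andP[yS /hoodP[y0 y0Y yy0]].
exists x0, y0, (inl (inl x)); split=> //; first by rewrite !inE.
apply: (@reach_arcs _ _ U _ _ (inl (inl x)) (inl (inr u))); rewrite ?inE //.
apply: (@reach_map _ _ _ _ _ U (fun v => inl (inr v))) uy => [v|v w vw|v vy vS].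
- by rewrite inE.
- by rewrite !inE.
apply: (@reach_arcs _ _ U _ _ (inl (inr v)) (inr y)); rewrite ?inE //.
  by move: vS; rewrite inE.
by apply: reach_snk; rewrite ?inE.
Qed.

End Constructions.

(** * Dyadic ranges, compression and the gap *)

Definition ceil_div (n k : nat) : nat := (n + k.-1) %/ k.

Lemma leq_ceil_div n k j : 0 < k -> (ceil_div n k <= j) = (n <= j * k).
Proof.
case: k => // k _.
by rewrite -ltnS ltn_divLR // mulSn /= addnC addSn ltnS leq_add2l.
Qed.

Lemma ceil_div_mul_geq n k : 0 < k -> n <= ceil_div n k * k.
Proof. by move=> k0; rewrite -leq_ceil_div. Qed.

Lemma ceil_div_mul_leq n k : ceil_div n k * k <= n + k.-1.
Proof. exact: leq_divM. Qed.

Lemma ceil_div_leq n k : 0 < k -> ceil_div n k <= n.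
Proof. by move=> k0; rewrite leq_ceil_div // leq_pmulr. Qed.

(** With [j0] equal to $n/2^i$ rounded up, [j] lies between [j0] and [2 * j0], and the disperser
    hoods of both sides share more than [2 * j0] points. *)
Lemma realizable_dyadic n i :
  realizable 'I_n 'I_n 1 (n * (4 * (i + 11)))
    (fun j => n <= j * 2 ^ i /\ j * 2 ^ i <= 2 * n).
Proof.
have [->|n0] := posnP n.
  by apply: realizable_empty => j; rewrite card_ord; case: j.
have pow0 : 0 < 2 ^ i by rewrite expn_gt0.
set j0 := ceil_div n (2 ^ i); have nj0 := ceil_div_mul_geq n pow0.
have j0_gt0 : 0 < j0 by move: nj0; rewrite -/j0; case: j0 => //; lia.
have [nb [nbD nbH]] := disperser_exists j0_gt0 nj0.
apply: realizable_weaken (realizable_layer nbD nbD) => //.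
  by rewrite !card_ord; lia.
move=> j j_gt0 _ _ [le1 le2] X Y jX jY; rewrite -leq_ceil_div // -/j0 in le1.
have le3 : j <= 2 * j0.
  by rewrite -(leq_pmul2r pow0) (leq_trans le2) // -mulnA leq_mul2l nj0.
have := nbH X (leq_trans le1 jX); have := nbH Y (leq_trans le1 jY).
have := max_card (mem (hood nb X :|: hood nb Y)); rewrite cardsU card_ord.
have := subset_leq_card (subsetIl (hood nb X) (hood nb Y)).
by move: #|_| #|_| #|_| => a b c; lia.
Qed.

Lemma realizable_low_density n p :
  realizable 'I_n 'I_n 1 (n * (44 * p.+1 ^ 2)) (fun j => n <= j * 2 ^ p).
Proof.
elim: p => [|p IHp].
  apply: realizable_weaken (realizable_dyadic n 0) => // j _; rewrite card_ord => jn _ le.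
  by split=> //; lia.
apply: realizable_weaken (realizable_union IHp (realizable_dyadic n p.+1)) => //.
  by rewrite -mulnDr leq_mul2l; apply/orP; right; nia.
move=> j _ _ _ le; have [le'|lt] := leqP n (j * 2 ^ p); [by left|right].
by split=> //; rewrite expnS; move: lt; move: (2 ^ p) => P; nia.
Qed.

Lemma realizable_compress n s b c Q :
  0 < s -> s <= n -> realizable 'I_(ceil_div n s) 'I_(ceil_div n s) b c Q ->
  realizable 'I_n 'I_n b.+2 (12 * n + c) (fun j => 64 * j * s ^ 2 <= n /\ Q j).
Proof.
move=> s0 sn; set N := ceil_div n s => QN; set J := n %/ (64 * s ^ 2).
have leN : n <= N * s by apply: ceil_div_mul_geq.
have leJ : 64 * J * s ^ 2 <= n by rewrite mulnAC mulnC leq_divM.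
have [|nb [nbD nbH]] := @expander_exists n N J 3.
  have le64 : 64 * n * J <= N ^ 2.
    have s2 : 0 < s ^ 2 by rewrite expn_gt0 s0.
    rewrite -(leq_pmul2r s2) -expnMn; apply: leq_trans (_ : n ^ 2 <= _).
      by move: (s ^ 2) leJ => q; nia.
    by rewrite leq_exp2r.
  have Jn : J <= n by apply: leq_div.
  (* Squaring gives $4096\,n^2J^2\le N^4$, and $J\le n$ turns this into the expander condition
     $256\,n(2J)^3\le N^4$. *)
  have := leq_mul le64 le64; rewrite -expnD => le; apply: leq_trans le.
  by rewrite !expnS expn0 muln1; move: Jn; nia.
apply: realizable_weaken (realizable_sandwich nbD nbD QN) => //.
  by rewrite !card_ord; lia.
move=> j _ _ _ [le Qj]; have jJ : j <= J.
  by rewrite leq_divRL ?muln_gt0 ?expn_gt0 ?s0 // mulnA (mulnC j).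
by split=> // X jX; apply: nbH.
Qed.

Lemma quadratic_leq_exp p : (4 * p + 29) ^ 2 <= 841 * 2 ^ p.
Proof.
rewrite -mulnn; elim: p => [|p IHp]; first by rewrite expn0; lia.
by rewrite expnS; move: (2 ^ p) IHp => P; lia.
Qed.

(** Compressing by $2^p$ with $p$ about $q/2$ leaves about $n/2^p$ vertices, and the $O(q)$ dyadic
    layers on them cost $O(q^2n/2^p)=O(n)$. For [q < 10] the layers are used directly. The base
    $841=29^2$ comes from $2q+7\le4p+29$. *)
Lemma realizable_gap : exists C, forall n q,
  realizable 'I_n 'I_n 3 (C * n)
    (fun j => n <= j * 2 ^ (2 * q + 6) /\ j * 2 ^ q <= 16 * n).
Proof.
exists (12 + 88 * 841) => n q; have [lt_q|le_q] := ltnP q 10.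
  apply: realizable_weaken (realizable_low_density n (2 * q + 6)) => //.
    have : (2 * q + 6).+1 ^ 2 <= 27 ^ 2 by rewrite leq_exp2r //; lia.
    by move: (_ ^ 2); nia.
  by move=> j _ _ _ [].
pose p := (q - 10)./2; have [q1 q2] : q <= 2 * p + 11 /\ 2 * p + 10 <= q by rewrite /p; lia.
have sparse j : j * 2 ^ q <= 16 * n -> 64 * j * (2 ^ p) ^ 2 <= n.
  have : 2 ^ (2 * p + 10) <= 2 ^ q by rewrite leq_exp2l.
  by rewrite expnD mulnC -expnM (mulnC p); move: (2 ^ (2 * p)) (2 ^ q) => P Q; nia.
have p0 : 0 < 2 ^ p by rewrite expn_gt0.
have [lt_n|le_n] := ltnP n (2 ^ p).
  by apply: realizable_empty => j j0 _ [_ /sparse]; nia.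
apply: realizable_weaken (realizable_compress p0 le_n
  (realizable_low_density _ (2 * q + 6))) => //.
  have := ceil_div_mul_leq n (2 ^ p); set N := ceil_div _ _ => leN.
  rewrite mulnDl leq_add2l -(leq_pmul2r p0).
  have : (2 * q + 6).+1 ^ 2 <= 841 * 2 ^ p.
    by apply: leq_trans (quadratic_leq_exp p); rewrite leq_exp2r //; lia.
  by move: (2 ^ p) (_ ^ 2) p0 le_n leN => P Q; nia.
move=> j _ _ _ [le1 /sparse le2]; split=> //.
by apply: leq_trans le1; apply: ceil_div_leq.
Qed.

(** * The recursion along the hierarchy *)

Lemma star_fun_gt0 (f : shrinking) n : 0 < star_fun f n.
Proof. by rewrite /star_fun; case: ex_minnP => i /andP[]. Qed.

Lemma star_fun_min (f : shrinking) n i : 0 < i -> iter i f n <= 1 -> star_fun f n <= i.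
Proof. by case: i => // i _; rewrite iterSr => /star_fun_leq. Qed.

Lemma star_funS (f : shrinking) n : 1 < f n -> star_fun f (f n) < star_fun f n.
Proof.
rewrite {2}/star_fun; case: ex_minnP => -[//|[|i]] /andP[_ le1] _ fn_gt1.
  by move: le1 fn_gt1 => /=; lia.
by rewrite ltnS; apply: star_fun_min => //; rewrite -iterSr.
Qed.

(* The constant [A] must not grow along the hierarchy, so it is a parameter. *)
Definition scalable (f : nat -> nat) (b A : nat) : Prop := forall n r,
  realizable 'I_n 'I_n b (A * (n * maxn 1 (f r))) (fun j => n <= j * r).

Lemma scalable_weaken f g b A A' :
  A <= A' -> (forall r, f r <= maxn 1 (g r)) -> scalable f b A -> scalable g b A'.
Proof.
move=> leA lefg sc n r; apply: realizable_weaken (sc n r) => //.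
by rewrite !leq_mul // geq_max leq_maxl lefg.
Qed.

(** The dyadic layers down to density $1/r$ cost $O(n\log^2r)$, which is $O(n\sqrt r)$. The factor
    18 comes from $(2u+1)^2\le9\cdot2^u$ and $2^u\le2\max(1,t)$. *)
Lemma scalable_sqrt : scalable PeanoNat.Nat.sqrt 1 (44 * 18).
Proof.
move=> n r; set t := PeanoNat.Nat.sqrt r; set p := up_log 2 r.
have r_lt : r < t.+1 ^ 2.
  have := PeanoNat.Nat.sqrt_spec r (PeanoNat.Nat.le_0_l r); rewrite -/t; nia.
have le_p : p.+1 ^ 2 <= 18 * maxn 1 t.
  set u := up_log 2 t.+1.
  have le_pu : p <= 2 * u.
    apply: up_log_min => //; rewrite mulnC expnM; apply: leq_trans (ltnW r_lt) _.
    by rewrite leq_exp2r // up_logP.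
  have : 2 ^ u <= 2 * maxn 1 t.
    have [t0|t0] := posnP t; first by rewrite /u t0 up_log1 expn0; lia.
    have /andP[+ _] := @up_log_bounds 2 t.+1 isT t0; rewrite -/u.
    have : 0 < u by rewrite up_log_gt0.
    by case: (u) => // v _; rewrite expnS /=; lia.
  have : (2 * u).+1 ^ 2 <= 9 * 2 ^ u.
    rewrite -mulnn; case: (u) => [|[|[|v]]]; rewrite ?expn0 //.
    elim: v => [|v IHv]; first by [].
    by rewrite expnS; move: (2 ^ v.+3) IHv => P; lia.
  have : p.+1 ^ 2 <= (2 * u).+1 ^ 2 by rewrite leq_exp2r.
  by move: (_ ^ 2) (_ ^ 2) (2 ^ u) (maxn _ _) => P Q V W; lia.
apply: realizable_weaken (realizable_low_density n p) => //.
  by move: (_ ^ 2) (maxn _ _) le_p => P W; nia.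
by move=> j _ _ _ le; apply: leq_trans le _; rewrite leq_mul2l up_logP ?orbT.
Qed.

Lemma scalable_star : exists A0, forall (f : shrinking) b A,
  A0 <= A -> 0 < b -> scalable f b A -> scalable (star f) b.+2 A.
Proof.
(* A step costs [12 + C] per vertex besides the compressed network, which costs at most $An/4$; [A0]
   keeps the former within $An/2$. *)
have [C gap] := realizable_gap; exists (2 * (12 + C)) => f b A leA b0 sc.
have step n r : 1 < r -> realizable 'I_n 'I_n b.+2 (A * n)
    (fun j => n <= j * r /\ j * f r <= n).
  move=> r_gt1; set F := maxn 1 (f r); set q := up_log 2 (8 * F).
  have F0 : 0 < F by rewrite leq_max.
  have q_lo : 8 * F <= 2 ^ q by apply: up_logP.
  have q_hi : 2 ^ q < 16 * F.
    have q0 : 0 < q by rewrite up_log_gt0 //; lia.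
    have F8 : 1 < 8 * F by lia.
    have /andP[+ _] := @up_log_bounds 2 (8 * F) isT F8; rewrite -/q.
    by case: (q) q0 => // v _; rewrite expnS /=; lia.
  have s0 : 0 < 2 ^ q by rewrite expn_gt0.
  have in_gap j : j <= n -> j * f r <= n -> n < 64 * j * (2 ^ q) ^ 2 ->
      n <= j * 2 ^ (2 * q + 6) /\ j * 2 ^ q <= 16 * n.
    move=> jn jF lt; have jF' : j * F <= n by rewrite /F maxnMr muln1 geq_max jn.
    rewrite expnD mulnC -expnM in lt *; split; last by nia.
    by move: lt; rewrite (mulnC q); lia.
  have {}gap : realizable 'I_n 'I_n b.+2 (C * n)
      (fun j => n <= j * 2 ^ (2 * q + 6) /\ j * 2 ^ q <= 16 * n).
    exact: realizable_weaken (gap n q).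
  (* When [n] is too small to compress, every positive [j] of the range is in the gap. *)
  have [lt_n|le_n] := ltnP n (2 ^ q).
    apply: realizable_weaken gap; [by [] | by nia |].
    move=> j j0; rewrite card_ord => jn _ [_ jF]; apply: in_gap => //.
    by move: (2 ^ q) lt_n => s; rewrite -mulnn; nia.
  apply: realizable_weaken (realizable_union (realizable_compress s0 le_n (sc _ r)) gap) => //.
    have := ceil_div_mul_leq n (2 ^ q); set N := ceil_div _ _ => leN.
    have NF : 4 * (N * F) <= n by nia.
    have ANF : 4 * (A * (N * F)) <= A * n by rewrite mulnCA leq_mul2l NF orbT.
    by rewrite -/F; nia.
  move=> j j0; rewrite card_ord => jn _ [jr jF].
  have [le|lt] := leqP (64 * j * (2 ^ q) ^ 2) n; last by right; apply: in_gap.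
  by left; split=> //; apply: leq_trans jr; apply: ceil_div_leq.
(* The range is split at $n/f(r)$: one step above, induction at [f r] below. Each application of [f]
   uses up one unit of [star_fun]; for [r <= 1] a step at 2 suffices, because [f 2 <= 1]. *)
move=> n; elim/ltn_ind => r IHr.
have star0 := star_fun_gt0 f r; rewrite (maxn_idPr star0).
have [r_le1|r_gt1] := leqP r 1.
  have f2 := shrinkP f (isT : 1 < 2).
  apply: realizable_weaken (step n 2 isT) => //.
    by rewrite leq_mul2l leq_pmulr ?orbT.
  by move=> j _; rewrite card_ord => jn _ le; split; nia.
have [f_le1|f_gt1] := leqP (f r) 1.
  apply: realizable_weaken (step n r r_gt1) => //.
    by rewrite leq_mul2l leq_pmulr ?orbT.
  by move=> j _; rewrite card_ord => jn _ le; split; nia.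
apply: realizable_weaken (realizable_union (step n r r_gt1) (IHr _ (shrinkP f r_gt1))) => //.
  have := star_funS f_gt1; have := star_fun_gt0 f (f r).
  rewrite -mulnDr leq_mul2l /=; move: (star_fun f (f r)) (star_fun f r) => x y; nia.
move=> j _ _ _ jr; have [le|lt] := leqP n (j * f r); first by right.
by left; split; last exact: ltnW.
Qed.

Lemma uphalf_shrink n : 1 < n -> uphalf n < n.
Proof. by lia. Qed.

Definition half_up : shrinking := Shrinking uphalf_shrink.

Lemma star_half_up_leq r : star half_up r <= maxn 1 (up_log 2 r).
Proof.
have iter_half k n : n <= 2 ^ k -> iter k half_up n <= 1.
  elim: k n => // k IHk n; rewrite expnS iterSr => le; apply: IHk => /=; lia.
apply: star_fun_min; first by rewrite leq_maxl.
apply: iter_half; apply: leq_trans (up_logP r (isT : 1 < 2)) _.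
by rewrite leq_exp2l // leq_maxr.
Qed.

(** Halving thus inherits depth parameter 1 and the constant of the square root, so its [star] can
    start the even levels. *)
Lemma sqrt_leq_half_up r : PeanoNat.Nat.sqrt r <= maxn 1 (half_up r).
Proof.
have := PeanoNat.Nat.sqrt_spec r (PeanoNat.Nat.le_0_l r).
by rewrite /=; move: (PeanoNat.Nat.sqrt r) => t; nia.
Qed.

Lemma scalable_lambda : exists A, forall d, scalable (lambda d.+1) d.+2 A.
Proof.
have [A0 star_step] := scalable_star; exists (A0 + 44 * 18).
have sqrtA : scalable PeanoNat.Nat.sqrt 1 (A0 + 44 * 18).
  by apply: scalable_weaken scalable_sqrt; [lia | move=> r; apply: leq_maxr].
(* [lambda] recurs two indices back, so the induction carries two consecutive levels. *)
suff both d : scalable (lambda d.+1) d.+2 (A0 + 44 * 18) /\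
    scalable (lambda d.+2) d.+3 (A0 + 44 * 18) by move=> d; case: (both d).
elim: d => [|d [IH1 IH2]].
  split.
    move=> n r; apply: realizable_weaken (sqrtA n r) => //.
  apply: (scalable_weaken (leqnn _) star_half_up_leq).
  apply: star_step => //; first by lia.
  by apply: scalable_weaken sqrt_leq_half_up sqrtA.
split=> //; rewrite lambdaS2 //; apply: star_step => //; lia.
Qed.

(** * Unequal numbers of inputs and outputs *)

Lemma alpha_gt0 m n : 0 < alpha m n.
Proof. by rewrite /alpha; case: ex_minnP => d /andP[]. Qed.

(** Both cases in the definition of [alpha] make the core network on $O(n)$ vertices cost $O(m)$;
    the factor 4 is the threshold of the second case. *)
Lemma lambda_alpha_leq m n : 0 < n -> n <= m ->
  n * maxn 1 (lambda (alpha m n) n) <= 4 * m.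
Proof.
move=> n0 nm; rewrite /alpha; case: ex_minnP => d /andP[_ cond] _.
move: cond; move: (lambda d n) => l; case: ifP => _; last by nia.
rewrite Num.Theory.ler_pdivlMr ?Num.Theory.ltr0n // -GRing.natrM Num.Theory.ler_nat; nia.
Qed.

(** Rounding $\sqrt{m/n}\ge1$ up at most doubles it, hence the 4. *)
Lemma ceil_sqrt_exists m n : 0 < n -> n <= m ->
  exists s, [/\ 0 < s, m <= n * s ^ 2 & n * s ^ 2 <= 4 * m].
Proof.
move=> n0 nm; have ex : exists s, m <= n * s ^ 2 by exists m; nia.
case: (ex_minnP ex) => s le_s min_s; exists s.
have s0 : 0 < s by case: (s) le_s => //; rewrite exp0n // muln0; lia.
split=> //; have := min_s s.-1; case: (s) s0 => // t _ /= min_t.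
have lt_t : n * t ^ 2 < m by rewrite ltnNge; apply/negP => /min_t; rewrite ltnn.
by case: t lt_t {min_t} => [|t]; rewrite -?mulnn; nia.
Qed.

Theorem realizable_superconcentrator : exists A, forall m n, 0 < n -> n <= m ->
  realizable 'I_m 'I_n (alpha m n + 5) (A * m) (fun=> True).
Proof.
have [A scA] := scalable_lambda; exists (852 + 16 * A) => m n n0 nm.
have [d dE] : exists d, alpha m n = d.+1.
  by case: (alpha m n) (alpha_gt0 m n) => // d _; exists d.
have lam := lambda_alpha_leq n0 nm; rewrite dE in lam *.
have [s [s0 le_s s_le]] := ceil_sqrt_exists n0 nm.
have expand k : k <= m -> 256 * k * (2 * n) ^ 3 <= (8 * n * s) ^ 4.
  move=> km; have le : k * n <= (n * s ^ 2) * (n * s ^ 2).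
    by apply: leq_mul (leq_trans km le_s) _; rewrite leq_pmulr // expn_gt0 s0.
  have := leq_mul (leqnn (n * n)) le.
  by rewrite !expnS !expn0 !muln1; nia.
have [nbI [DI hoodI]] := expander_exists (expand m (leqnn m)).
have [nbO [DO hoodO]] := expander_exists (expand n nm).
(* The degree [s + 12] is affordable: $8ns(s+12)=O(ns^2)=O(m)$. *)
have [|nb [nbD nbH]] := @expander_exists (8 * n * s) (4 * n) n (s + 9).
  have le_s2 : 512 * s <= 2 ^ (s + 9).
    by rewrite addnC expnD leq_mul2l ltnW ?orbT // ltn_expl.
  move: (s + 9) le_s2 => e; rewrite expnS -[4]/(2 * 2) !expnMn => le_s2.
  have := leq_mul le_s2 (leqnn (n * (2 ^ e * n ^ e))).
  by move: (2 ^ e) (n ^ e) => P Q; nia.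
(* The core has [4 * n] vertices and is used with [r = n], so it serves only [j >= 4]. Four vertices
   joined to all inputs and outputs serve [j <= 4]. *)
have hubs : realizable 'I_m 'I_n (d.+1 + 5) ((m + n) * 4) (fun j => j <= 4).
  have card4 : #|[set: 'I_4]| <= 4 by rewrite cardsT card_ord.
  have := realizable_layer (I := 'I_m) (O := 'I_n) (fun=> card4) (fun=> card4).
  apply: realizable_weaken => [||j j0 _ _ j4 X Y jX jY]; rewrite ?card_ord //.
  have hoodT (T : finType) (Z : {set T}) :
      j <= #|Z| -> hood (fun=> [set: 'I_4]) Z = setT.
    move=> jZ; have /set0Pn[z zZ] : Z != set0 by rewrite -card_gt0 (leq_trans j0).
    by apply/setP => i; rewrite in_setT; apply/hoodP; exists z.
  by rewrite !hoodT // setIT cardsT card_ord.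
have core := realizable_sandwich DI DO (realizable_sandwich nbD nbD (scA d (4 * n) n)).
have {}core := realizable_weaken (_ : _ <= d.+1 + 5) (leqnn _) (fun j _ _ _ q => q) core.
apply: realizable_weaken (realizable_union hubs (core _)) => //; last 1 first.
- by lia.
- rewrite !card_ord; move: (maxn _ _) lam => l lam.
  have : n * (s * (s + 12)) <= 13 * (n * s ^ 2) by rewrite -mulnn; nia.
  by have := leq_mul (leqnn A) lam; nia.
move=> j _ _; rewrite card_ord => jn _; have [j4|j4] := leqP j 4; [by left|right].
split; [split; [nia|..]|..] => X jX; first [exact: nbH | exact: hoodI | exact: hoodO].
Qed.

Theorem theorem4 :
  exists A B : nat, forall m n : nat, 1 <= n -> n <= m ->
    exists G : network m n,
      [/\ superconcentrator G,
          num_edges G <= A * m &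
          depth G <= alpha m n + B].
Proof.
have [A realA] := realizable_superconcentrator; exists A, 6 => m n n0 nm.
have [G [Gl Gc Gr]] := realA m n n0 nm.
exists (net (card_ord m) (card_ord n) Gl); split.
- by apply: net_superconcentrator => j; apply: Gr.
- by rewrite net_num_edges.
by apply: leq_trans (net_depth _ _ _) _; lia.
Qed.
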